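(* Let $M$ be a differentiable manifold, $D$ an $S$-derivation and $x_0\in M$. If there is a local holonomic basis, defined in a neighborhood of $x_0$, in which the components of $D$ along every vector field vanish at $x_0$, then the torsion of $D$ is zero at $x_0$. Conversely, if $D$ is torsion free at $x_0$ and there exist local bases in which the components of $D$ along every vector field vanish at $x_0$, then all such bases are holonomic at $x_0$.
   Context: $n=\dim M$; latin indices run from $1$ to $n$ and repeated indices on different levels are summed. $S$-derivation: let $S:X\mapsto S_X$ be a map (no linearity is assumed) from $C^1$ vector fields to tensor fields of type $(1,1)$. For each $X$ the formula $D_X=L_X+S_X$ defines a derivation of the tensor algebra over $M$, where $L_X$ is the Lie derivative along $X$ and $S_X$ acts as the algebraic derivation induced by the endomorphism field $S_X$ (so $S_X f=0$ on functions and $S_X Y=S_X(Y)$ on vector fields). The map $D:X\mapsto D_X$ is called an $S$-derivation. Components: in a local basis (frame) $\{E_i\}$ of $C^1$ vector fields (not necessarily a coordinate one), the components of $D_X$ are the functions $(W_X)^i_{.j}$ defined by $D_X(E_j)=(W_X)^i_{.j}E_i$. Torsion: $T^D(X,Y)=D_XY-D_YX-[X,Y]$. The torsion of $D$ is zero at $x_0$ ($D$ is torsion free at $x_0$) if $T^D(X,Y)|_{x_0}=0$ for all vector fields $X,Y$. A local basis $\{E_i\}$ is holonomic if $[E_i,E_j]=0$ for all $i,j$ in its domain; it is holonomic at $x_0$ if $[E_i,E_j]|_{x_0}=0$ for all $i,j$. *)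

(* Defs.v *)
From HB Require Import structures.
From mathcomp Require Import all_boot all_order all_algebra.
From mathcomp Require Import all_classical all_reals all_analysis.

Set Implicit Arguments.
Unset Strict Implicit.
Unset Printing Implicit Defensive.

Import Order.TTheory GRing.Theory Num.Theory.
Import numFieldNormedType.Exports.
Local Open Scope classical_set_scope.
Local Open Scope ring_scope.

Section Smoothness.
Variables (R : realType) (V W : normedModType R).

(* Intended for open A. *)
Fixpoint Ck (k : nat) (A : set V) (f : V -> W) : Prop :=
  match k with
  | 0 => forall x, A x -> {for x, continuous f}
  | k'.+1 => (forall x, A x -> differentiable f x) /\
             (forall v : V, Ck k' A (fun x => 'D_v f x))
  end.

End Smoothness.

Section Manifolds.
Variables (R : realType) (n : nat).

Record chart (T : topologicalType) := Chart {
  chart_fun :> T -> 'rV[R]_n ;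
  chart_inv : 'rV[R]_n -> T ;
  chart_dom : set T ;
  chart_dom_open : open chart_dom ;
  chart_img_open : open (chart_fun @` chart_dom) ;
  chart_funK : {in chart_dom, cancel chart_fun chart_inv} ;
  chart_cont : forall p, chart_dom p -> {for p, continuous chart_fun} ;
  chart_inv_cont : forall p, chart_dom p ->
    {for chart_fun p, continuous chart_inv} }.

(* Class C^2 is what is needed for C^1 vector fields and their brackets to be
   defined; the atlas need not be maximal, so an atlas of any class C^r with
   2 <= r <= oo is also one in this sense. *)
Record manifold := Manifold {
  points :> topologicalType ;
  atlas : set (chart points) ;
  points_hausdorff : hausdorff_space points ;
  atlas_cover : forall p : points,
    exists c : chart points, atlas c /\ chart_dom c p ;
  atlas_compat : forall c d : chart points, atlas c -> atlas d ->
    Ck 2 (c @` (chart_dom c `&` chart_dom d)) (d \o chart_inv c) }.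

Variable M : manifold.

Definition chart_at (p : M) : chart M := projT1 (cid (atlas_cover p)).

(* The tangent space at p is R^n: v : 'rV[R]_n stands for the tangent vector
   having components v in the coordinate basis of the chart [chart_at p].
   Vector fields and tensor fields are therefore functions on M whose value at
   p is expressed in the chart [chart_at p], and regularity can only be read
   off after changing to a fixed chart. *)
Definition vfield := M -> 'rV[R]_n.

(* Components of the tangent vector v at p in the coordinate basis of c. *)
Definition in_chart (c : chart M) (p : M) (v : 'rV[R]_n) : 'rV[R]_n :=
  'd (c \o chart_inv (chart_at p)) (chart_at p p) v.

Definition local_rep (c : chart M) (X : vfield) : 'rV[R]_n -> 'rV[R]_n :=
  fun x => in_chart c (chart_inv c x) (X (chart_inv c x)).

Definition C1_on (U : set M) (X : vfield) : Prop :=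
  forall c : chart M, atlas c ->
    Ck 1 (c @` (U `&` chart_dom c)) (local_rep c X).

Record C1field := C1Field {
  c1val :> vfield ;
  c1valP : C1_on setT c1val }.

(* [X, Y]^i = X^k d_k Y^i - Y^k d_k X^i, in the chart [chart_at p]. *)
Definition bracket (X Y : vfield) : vfield := fun p =>
  let c := chart_at p in
  let x := c p in
  'd (local_rep c Y) x (local_rep c X x)
  - 'd (local_rep c X) x (local_rep c Y x).

Definition lie_derivative (X Y : vfield) : vfield := bracket X Y.

(* Entry (j, i) of the matrix at p is the component S^i_{.j}, so that
   S(Y) = Y *m S for row vectors. *)
Definition tensor11 := M -> 'M[R]_n.

Definition S_map := C1field -> tensor11.

(* The S-derivation D_X = L_X + S_X on vector fields; on functions it is X f,
   and these two determine it on all tensor fields. The value at p only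
   depends on Y near p, so Y may be a local field extended arbitrarily. *)
Definition S_derivation (S : S_map) (X : C1field) (Y : vfield) : vfield :=
  fun p => lie_derivative X Y p + Y p *m S X p.

Definition torsion (S : S_map) (X Y : C1field) : vfield := fun p =>
  S_derivation S X Y p - S_derivation S Y X p - bracket X Y p.

Definition torsion_free_at (S : S_map) (x0 : M) : Prop :=
  forall X Y : C1field, torsion S X Y x0 = 0.

(* The values of the fields outside of the domain are irrelevant. *)
Record local_basis := LocalBasis {
  lb_fun :> 'I_n -> vfield ;
  lb_dom : set M ;
  lb_dom_open : open lb_dom ;
  lb_C1 : forall i, C1_on lb_dom (lb_fun i) ;
  lb_basis : forall p, lb_dom p ->
    basis_of fullv [tuple lb_fun i p | i < n] }.

(* (W_X)^i_{.j}(p), the i-th coefficient of D_X(E_j) in the basis E at p. *)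
Definition component (S : S_map) (E : local_basis) (X : C1field) (i j : 'I_n)
    (p : M) : R :=
  coord [tuple E k p | k < n] i (S_derivation S X (E j) p).

Definition components_vanish_at (S : S_map) (E : local_basis) (x0 : M) : Prop :=
  forall (X : C1field) (i j : 'I_n), component S E X i j x0 = 0.

Definition holonomic_at (E : local_basis) (x0 : M) : Prop :=
  forall i j : 'I_n, bracket (E i) (E j) x0 = 0.

Definition holonomic (E : local_basis) : Prop :=
  forall p, lb_dom E p -> holonomic_at E p.

End Manifolds.

(* Main.v *)
From HB Require Import structures.
Require Import Defs.
From mathcomp Require Import all_boot all_order all_algebra.
From mathcomp Require Import all_classical all_reals all_analysis.
From mathcomp Require Import ring lra.

(** Let the frame [E] around [x0] have vanishing components at [x0]. This says
    [D_X E_j = 0] at [x0] for every field [X], that is,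
    [S_X E_j = - [X, E_j]] there, so the frame determines [S_X] at [x0]. Write
    [a] and [b] for the coordinates of [X x0] and [Y x0] in the frame.
    Substituting [S_X Y = - b^j [X, E_j]] and [S_Y X = - a^i [Y, E_i]] in
    [T(X, Y) = S_X Y - S_Y X + [X, Y]], the derivatives of [X] and of [Y]
    cancel and what remains is
      [T(X, Y) = - a^i b^j [E_i, E_j]]   at [x0]          ([torsion_frame]).
    If the frame is holonomic the right-hand side is zero, which is the first
    implication.

    For the converse, take [X] and [Y] with [X x0 = E_i x0] and
    [Y x0 = E_j x0]; the formula then reads [0 = - [E_i, E_j]] at [x0]. The
    torsion is only evaluated on fields defined on all of [M], whereas the
    frame is local, so global C^1 fields with a prescribed value at [x0] are
    needed ([C1field_through]): the coordinate field of the chart at [x0] is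
    multiplied by a compactly supported C^1 bump function ([bump]) and extended
    by zero. Compactness of the support and the Hausdorff property make the
    extension vanish near every point outside the chart domain. *)

Set Implicit Arguments.
Unset Strict Implicit.
Unset Printing Implicit Defensive.

Import Order.TTheory GRing.Theory Num.Theory.
Import numFieldNormedType.Exports.
Local Open Scope classical_set_scope.
Local Open Scope ring_scope.

(** * Differentials are local *)

Section Calculus.
Variables (R : realType) (V W : normedModType R).
Implicit Types (f g : V -> W) (x : V).

(** The form in which a remainder estimate is used: a function that is
    [o(y - x)] at [x] has differential zero there. *)
Lemma is_diff0 f x : f x = 0 ->
  (forall e : R, 0 < e -> \forall y \near x, `|f y| <= e * `|y - x|) ->
  is_diff x f 0.
Proof.
move=> fx0 fo.
have fE : f \o shift x = cst (f x) + (\0 : {linear V -> W}) +o_ 0 id.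
  apply/eqaddoP => e e0; rewrite fx0.
  rewrite [\forall y \near _, _ <= _](near_shift x) sub0r.
  apply: filterS (fo e e0) => y /=.
  by rewrite !fctE /= subrK !addr0 subr0.
have dc : continuous (\0 : {linear V -> W}) by move=> ?; exact: cvg_cst.
have d0 := diff_unique dc fE.
by apply: DiffDef; [apply/diff_locallyP; rewrite d0 | rewrite d0].
Qed.

(** The difference [g - f] vanishes near [x], hence has differential zero by
    [is_diff0], and [g = f + (g - f)]. *)
Lemma near_eq_is_diff f g df x :
  (\forall y \near x, f y = g y) -> is_diff x f df -> is_diff x g df.
Proof.
move=> fg dfx.
have d0 : is_diff x (g - f) 0.
  apply: is_diff0 => [|e e0].
    by rewrite !fctE (nbhs_singleton fg) subrr.
  near=> y; rewrite !fctE (near fg y) // subrr normr0.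
  by rewrite mulr_ge0 // ltW.
have := is_diffD dfx d0; rewrite addr0.
by congr is_diff_def; apply/funext => y; rewrite !fctE addrC subrK.
Unshelve. all: by end_near. Qed.

Lemma near_eq_differentiable f g x :
  (\forall y \near x, f y = g y) -> differentiable f x -> differentiable g x.
Proof. by move=> fg /differentiableP /(near_eq_is_diff fg) []. Qed.

Lemma near_eq_diff f g x :
  (\forall y \near x, f y = g y) -> differentiable f x ->
  'd f x = 'd g x :> (V -> W).
Proof. by move=> fg /differentiableP /(near_eq_is_diff fg) [_ ->]. Qed.

End Calculus.

(** * Functions of class C^1 at a point *)

(** Differentiability is asked on a neighborhood, and not just at [x], so that
    the directional derivatives near [x] can be computed by the usual rules;
    on an open set this is the same as [Ck 1] (lemma [Ck1P]). *)
Definition C1_at (R : realType) (V W : normedModType R) (f : V -> W) (x : V) :=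
  (\forall y \near x, differentiable f y) /\
  forall v, {for x, continuous (fun y => 'D_v f y)}.

Section C1.
Variables (R : realType) (V : normedModType R).

Lemma Ck1P (W : normedModType R) (A : set V) (f : V -> W) : open A ->
  Ck 1 A f <-> forall x, A x -> C1_at f x.
Proof.
move=> oA; split => [[df cf] x Ax|fA].
  split; last by move=> v; exact: cf.
  by apply: filterS df _; apply: open_nbhs_nbhs.
by split => [x /fA [/nbhs_singleton]|v x /fA []] //.
Qed.

Lemma C1_at_near (W : normedModType R) (f g : V -> W) x :
  (\forall y \near x, f y = g y) -> C1_at f x -> C1_at g x.
Proof.
move=> /near_join fg [df cf]; split.
  near=> y; apply: (@near_eq_differentiable _ _ _ f).
    by near: y.
  by near: y.
move=> v; rewrite /prop_for /continuous_at.
rewrite -(near_eq_derive v (nbhs_singleton fg)).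
apply: cvg_trans (cf v); apply: near_eq_cvg.
near=> y; apply: near_eq_derive; by near: y.
Unshelve. all: by end_near. Qed.

Lemma C1_at_cst (W : normedModType R) (k : W) x : C1_at (cst k : V -> W) x.
Proof.
split; first by near=> y; exact: differentiable_cst.
move=> v; rewrite (_ : (fun _ => _) = cst 0); first exact: cvg_cst.
by apply/funext => y; rewrite derive_cst.
Unshelve. all: by end_near. Qed.

Lemma C1_at_lin (W : normedModType R) (f : {linear V -> W}) x :
  continuous f -> C1_at f x.
Proof.
move=> fc; split; first by near=> y; exact: linear_differentiable.
move=> v; rewrite (_ : (fun _ => _) = cst (f v)); first exact: cvg_cst.
apply/funext => y; rewrite deriveE; last exact: linear_differentiable.
by rewrite diff_lin.
Unshelve. all: by end_near. Qed.

Lemma C1_at_add (W : normedModType R) (f g : V -> W) x :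
  C1_at f x -> C1_at g x -> C1_at (f + g) x.
Proof.
move=> [df cf] [dg cg]; split.
  by near=> y; apply: differentiableD; near: y.
move=> v.
have E : \forall y \near x, 'D_v f y + 'D_v g y = 'D_v (f + g) y.
  near=> y; rewrite deriveD //; apply: diff_derivable; by near: y.
rewrite /prop_for /continuous_at -(nbhs_singleton E).
apply: cvg_trans (near_eq_cvg E) _; apply: cvgD; [exact: cf|exact: cg].
Unshelve. all: by end_near. Qed.

Lemma C1_at_sum (W : normedModType R) m (f : 'I_m -> V -> W) x :
  (forall i, C1_at (f i) x) -> C1_at (\sum_(i < m) f i) x.
Proof.
move=> fx; elim/big_ind : _ => // [|g h]; [exact: C1_at_cst|exact: C1_at_add].
Qed.

Lemma C1_at_mul (f g : V -> R) x : C1_at f x -> C1_at g x -> C1_at (f * g) x.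
Proof.
move=> [df cf] [dg cg]; split.
  by near=> y; apply: differentiableM; near: y.
move=> v.
have E : \forall y \near x, f y *: 'D_v g y + g y *: 'D_v f y = 'D_v (f * g) y.
  near=> y; rewrite deriveM //; apply: diff_derivable; by near: y.
rewrite /prop_for /continuous_at -(nbhs_singleton E).
apply: cvg_trans (near_eq_cvg E) _.
have fc := differentiable_continuous (nbhs_singleton df).
have gc := differentiable_continuous (nbhs_singleton dg).
by apply: cvgD; apply: cvgM => //; [exact: cg|exact: cf].
Unshelve. all: by end_near. Qed.

Lemma C1_at_Zl (W : normedModType R) (k : W) (f : V -> R) x :
  C1_at f x -> C1_at (fun y => f y *: k) x.
Proof.
move=> [df cf]; split.
  by near=> y; apply: differentiableZl; near: y.
move=> v.
have E : \forall y \near x, 'D_v f y *: k = 'D_v (fun y => f y *: k) y.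
  near=> y; have dfy : differentiable f y by near: y.
  by rewrite !deriveE ?diffZl //; exact: differentiableZl.
rewrite /prop_for /continuous_at -(nbhs_singleton E).
by apply: cvg_trans (near_eq_cvg E) _; apply: cvgZr_tmp; exact: cf.
Unshelve. all: by end_near. Qed.

(** Continuity of [y |-> 'd f (g y) ('D_v g y)] is reduced to that of the
    finitely many partial derivatives of [f] by expanding ['D_v g y] in the
    canonical basis; this is why the intermediate space is ['rV_m]. *)
Lemma C1_at_comp (W : normedModType R) m (g : V -> 'rV[R]_m)
    (f : 'rV[R]_m -> W) x : C1_at g x -> C1_at f (g x) -> C1_at (f \o g) x.
Proof.
move=> [dg cg] [df cf].
have gc := differentiable_continuous (nbhs_singleton dg).
have dfg : \forall y \near x, differentiable f (g y) := gc _ df.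
split; first by near=> y; apply: differentiable_comp; near: y.
move=> v.
have E : \forall y \near x,
    \sum_(i < m) 'D_v g y 0 i *: 'D_(delta_mx 0 i) f (g y) = 'D_v (f \o g) y.
  near=> y; have dgy : differentiable g y by near: y.
  have dfy : differentiable f (g y) by near: y.
  rewrite [RHS]deriveE; last exact: differentiable_comp.
  rewrite diff_comp //= [X in 'd f _ X]row_sum_delta linear_sum.
  by apply: eq_bigr => i _; rewrite linearZ /= !deriveE.
rewrite /prop_for /continuous_at -(nbhs_singleton E).
apply: cvg_trans (near_eq_cvg E) _.
apply: cvg_big => [|i _]; first exact: add_continuous.
apply: cvgZ.
  apply: (@continuous_comp _ _ _ (fun y => 'D_v g y) (fun N : 'rV_m => N 0 i)).
    exact: cg.
  exact: coord_continuous.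
by apply: (@continuous_comp _ _ _ g ('D_(delta_mx 0 i) f)) => //; exact: cf.
Unshelve. all: by end_near. Qed.

End C1.

(** * Bump functions *)

Section SquaredPositivePart.
Variable R : realType.

Let sqr_pos (t : R) : R := Num.max 0 t ^+ 2.

(** One estimate, valid for every [t], gives differentiability of
    [t |-> (max 0 t)^2] at the kink [t = 0] and elsewhere alike. *)
Let sqr_pos_remainder (s t : R) :
  `|sqr_pos s - sqr_pos t - 2 * Num.max 0 t * (s - t)| <= (s - t) ^+ 2.
Proof.
rewrite ler_norml /sqr_pos.
have := sqr_ge0 (s - t); rewrite !expr2.
case: (ltP 0 s) => s0; case: (ltP 0 t) => t0 q0; apply/andP; split; nra.
Qed.

Lemma is_diff_sqr_pos (t : R) :
  is_diff t (fun s : R => Num.max 0 s ^+ 2) (fun s : R => 2 * Num.max 0 t * s).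
Proof.
set m := 2 * _.
pose l : R -> R := cst (sqr_pos t) + m *: (id - cst t).
have dl : is_diff t l (0 + m *: (id - 0)).
  apply: is_diffD; apply: is_diffZ; exact: is_diffB.
have dr : is_diff t (sqr_pos - l) 0.
  apply: is_diff0 => [|e e0].
    by rewrite /l !fctE subrr scaler0 addr0 subrr.
  near=> s; rewrite /l !fctE opprD addrA.
  apply: le_trans (sqr_pos_remainder s t) _.
  by rewrite -[_ ^+ 2]ger0_norm ?sqr_ge0 // normrX expr2 ler_wpM2r //.
by have := is_diffD dr dl; rewrite subrK !add0r subr0.
Unshelve. all: by end_near. Qed.

End SquaredPositivePart.

Lemma C1_at_sqr_pos (R : realType) (V : normedModType R) (g : V -> R) x :
  C1_at g x -> C1_at (fun y => Num.max 0 (g y) ^+ 2) x.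
Proof.
move=> [dg cg].
have dh y : differentiable g y ->
    is_diff y (fun y => Num.max 0 (g y) ^+ 2)
      ((fun s : R => 2 * Num.max 0 (g y) * s) \o 'd g y).
  by move=> /differentiableP dgy; exact: is_diff_comp dgy (is_diff_sqr_pos (g y)).
split.
  near=> y; have /dh [] // : differentiable g y by near: y.
move=> v.
(* [g + `|g|] is [2 * max 0 g] in a form whose continuity is immediate. *)
have E : \forall y \near x,
    (g y + `|g y|) * 'D_v g y = 'D_v (fun y => Num.max 0 (g y) ^+ 2) y.
  near=> y; have dgy : differentiable g y by near: y.
  have [dhy dhE] := dh y dgy.
  rewrite [RHS]deriveE // dhE /= -deriveE //; congr (_ * _).
  by case: ltP => g0; [rewrite gtr0_norm|rewrite ler0_norm] => //; ring.
rewrite /prop_for /continuous_at -(nbhs_singleton E).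
apply: cvg_trans (near_eq_cvg E) _.
have gc : g @ x --> g x := differentiable_continuous (nbhs_singleton dg).
apply: cvgM; last exact: cg.
by apply: cvgD => //; exact: cvg_norm.
Unshelve. all: by end_near. Qed.

Lemma C1_at_coord (R : realType) m i (x : 'rV[R]_m) :
  C1_at (fun N : 'rV[R]_m => N 0 i) x.
Proof.
have lin : linear (fun N : 'rV[R]_m => N 0 i : R^o).
  by move=> k u v; rewrite !mxE.
pose f : {linear 'rV[R]_m -> R^o} :=
  HB.pack (fun N : 'rV[R]_m => N 0 i : R^o) (GRing.isLinear.Build _ _ _ _ _ lin).
exact: (@C1_at_lin _ _ _ f x (@coord_continuous _ _ _ 0 i)).
Qed.

Lemma C1_at_scale (R : realType) m (k : 'rV[R]_m -> R)
    (f : 'rV[R]_m -> 'rV[R]_m) x :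
  C1_at k x -> C1_at f x -> C1_at (fun y => k y *: f y) x.
Proof.
move=> kx fx.
have -> : (fun y => k y *: f y) =
    \sum_(i < m) (fun y =>
      (k * ((fun N : 'rV[R]_m => N 0 i) \o f)) y *: delta_mx 0 i).
  apply/funext => y; rewrite fct_sumE [X in _ *: X]row_sum_delta scaler_sumr.
  by apply: eq_bigr => i _; rewrite scalerA.
apply: C1_at_sum => i.
have fi := C1_at_comp fx (C1_at_coord i (f x)).
exact: (C1_at_Zl (delta_mx 0 i) (C1_at_mul kx fi)).
Qed.

(** The function is a multiple of [(max 0 (r^2 - |z - a|^2))^2], with the
    Euclidean norm, because the norm of ['rV_n] itself is not differentiable;
    its support lies in a closed cube, which is compact. *)
Lemma bump (R : realType) n (a : 'rV[R]_n) (U : set 'rV[R]_n) : nbhs a U ->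
  exists k : 'rV[R]_n -> R, exists K : set 'rV[R]_n,
    [/\ forall z, C1_at k z, k a = 1, compact K, K `<=` U &
        forall z, ~ K z -> k z = 0].
Proof.
(* Half of [e] keeps the closed cube of radius [r] inside the open ball. *)
move=> /nbhs_ballP[e /= e0 eU]; pose r := e / 2.
have r0 : 0 < r by rewrite divr_gt0.
pose g := cst (r ^+ 2) + \sum_(i < n)
  (fun z : 'rV[R]_n => (z 0 i - a 0 i) * (a 0 i - z 0 i)).
have gE z : g z = r ^+ 2 - \sum_(i < n) (z 0 i - a 0 i) ^+ 2.
  rewrite /g !fctE fct_sumE -sumrN; congr (_ + _); apply: eq_bigr => i _; ring.
have ga : g a = r ^+ 2.
  by rewrite gE big1 ?subr0 // => i _; rewrite subrr expr0n.
pose K := [set z : 'rV[R]_n | forall i, `[a 0 i - r, a 0 i + r]%classic (z 0 i)].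
exists (fun z => (Num.max 0 (g z) ^+ 2) *: (r ^- 4 : R^o)), K; split.
- move=> z; apply: C1_at_Zl; apply: C1_at_sqr_pos; apply: C1_at_add.
    exact: C1_at_cst.
  apply: C1_at_sum => i.
  have ci := C1_at_coord i z; have cc b := @C1_at_cst R 'rV[R]_n R b z.
  apply: C1_at_mul; first exact: C1_at_add ci (cc (- a 0 i)).
  rewrite (_ : (fun z => _) =
    cst (a 0 i) + cst (-1) * (fun z : 'rV[R]_n => z 0 i)).
    exact: C1_at_add (cc _) (C1_at_mul (cc _) ci).
  by apply/funext => y; rewrite !fctE mulN1r.
- rewrite ga (max_idPr _) ?exprn_ge0 ?ltW // -exprM.
  by rewrite /GRing.scale /= mulfV // expf_neq0 // gt_eqF.
- exact: (@rV_compact _ _ (fun i => `[a 0 i - r, a 0 i + r]%classic)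
    (fun i => @segment_compact _ _ _)).
- move=> z Kz; apply: eU; split=> // i j; rewrite ord1; have := Kz j.
  rewrite /= in_itv /= => /andP[za az].
  by rewrite /ball /= ltr_norml /r in za az *; apply/andP; split; lra.
- move=> z Kz; suff gz : g z <= 0 by rewrite (max_idPl _) // expr0n scale0r.
  rewrite leNgt gE subr_gt0; apply/negP => zr; apply: Kz => i.
  have : (z 0 i - a 0 i) ^+ 2 <= r ^+ 2.
    apply: le_trans (ltW zr); rewrite (bigD1 i) //= lerDl.
    by apply: sumr_ge0 => j _; exact: sqr_ge0.
  by rewrite /= in_itv /= !expr2 => zr2; apply/andP; split; nra.
Qed.

(** * Charts and globally defined C^1 fields *)

Section Charts.
Variables (R : realType) (n : nat) (M : manifold R n).
Implicit Types (c d : chart R n M) (p : M).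

Lemma chart_at_dom p : chart_dom (chart_at p) p.
Proof. by rewrite /chart_at; case: cid => c []. Qed.

Lemma chart_at_atlas p : atlas (chart_at p).
Proof. by rewrite /chart_at; case: cid => c []. Qed.

Lemma chartK c p : chart_dom c p -> chart_inv c (c p) = p.
Proof. by move=> cp; apply: chart_funK; rewrite inE. Qed.

Lemma near_chart_img c p : chart_dom c p ->
  \forall z \near c p, (c @` chart_dom c) z.
Proof.
move=> cp; apply: open_nbhs_nbhs; split; first exact: chart_img_open.
by exists p.
Qed.

(** Tangent vectors at [p] are by convention written in the chart
    [chart_at p], where the change of coordinates is the identity. *)
Lemma in_chart_at p v : in_chart (chart_at p) p v = v.
Proof.
rewrite /in_chart -(@near_eq_diff _ _ _ id) ?diff_val //.
near=> z; have : (chart_at p @` chart_dom (chart_at p)) z.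
  by near: z; apply: near_chart_img; exact: chart_at_dom.
by move=> [q cq <-] /=; rewrite chartK.
Unshelve. all: by end_near. Qed.

Lemma bracketE X Y p : bracket X Y p =
  'd (local_rep (chart_at p) Y) (chart_at p p) (X p) -
  'd (local_rep (chart_at p) X) (chart_at p p) (Y p).
Proof.
by rewrite /bracket /local_rep !(chartK (chart_at_dom p)) !in_chart_at.
Qed.

Lemma near_overlap c d p : chart_dom c p -> chart_dom d p ->
  \forall z \near c p, (c @` (chart_dom c `&` chart_dom d)) z.
Proof.
move=> cp dp.
have ic : chart_inv c @ c p --> p.
  by rewrite -{2}(chartK cp); exact: chart_inv_cont.
have nd : \forall z \near c p, chart_dom d (chart_inv c z).
  by apply: ic; apply: open_nbhs_nbhs; split => //; exact: chart_dom_open.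
near=> z; have [q cq zq] : (c @` chart_dom c) z.
  by near: z; exact: near_chart_img.
exists q => //; split => //; rewrite -(chartK cq) zq.
by near: z.
Unshelve. all: by end_near. Qed.

Lemma overlap_open c d : open (c @` (chart_dom c `&` chart_dom d)).
Proof. by rewrite openE => _ [p [cp dp] <-]; exact: near_overlap. Qed.

Lemma transition_C1 c d p : atlas c -> atlas d -> chart_dom c p ->
  chart_dom d p -> C1_at (d \o chart_inv c) (c p).
Proof.
move=> ac ad cp dp; have [df cf] := atlas_compat ac ad.
apply: ((Ck1P _ (overlap_open (c := c) (d := d))).1 _ (c p)); last by exists p.
split=> // v z zA; apply: differentiable_continuous.
by have [+ _] := cf v; apply.
Qed.

(** Here the atlas has to be of class C^2, and not just C^1. *)
Lemma transition_derive_C1 c d p v : atlas c -> atlas d -> chart_dom c p ->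
  chart_dom d p -> C1_at (fun z => 'D_v (d \o chart_inv c) z) (c p).
Proof.
move=> ac ad cp dp; have [_ /(_ v) cf] := atlas_compat ac ad.
by apply: ((Ck1P _ (overlap_open (c := c) (d := d))).1 cf); exists p.
Qed.

Lemma transition_diff c d p : atlas c -> atlas d -> chart_dom c p ->
  chart_dom d p -> differentiable (d \o chart_inv c) (c p).
Proof. by move=> ac ad cp dp; have [/nbhs_singleton] := transition_C1 ac ad cp dp. Qed.

(** Vectors in [C1field_through] pass from [c] to [chart_at p] and then to
    [d]; this makes the result independent of the intermediate chart, which
    varies with [p] in no regular way. *)
Lemma transition_chain a c d p w : atlas a -> atlas c -> atlas d ->
  chart_dom a p -> chart_dom c p -> chart_dom d p ->
  'd (d \o chart_inv a) (a p) ('d (a \o chart_inv c) (c p) w) =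
  'd (d \o chart_inv c) (c p) w.
Proof.
move=> aa ac ad ap cp dp.
have dac := transition_diff aa ad ap dp.
have dca := transition_diff ac aa cp ap.
have pE : (a \o chart_inv c) (c p) = a p by rewrite /= chartK.
pose g := (d \o chart_inv a) \o (a \o chart_inv c).
have near_g : \forall z \near c p, (d \o chart_inv c) z = g z.
  near=> z; have [q [cq aq] <-] : (c @` (chart_dom c `&` chart_dom a)) z.
    by near: z; exact: near_overlap.
  by rewrite /g /= (chartK cq) chartK.
have dE := near_eq_diff near_g (transition_diff ac ad cp dp).
rewrite -pE in dac.
have gE := diff_comp dca dac; rewrite pE in gE.
by rewrite [RHS](congr1 (@^~ w) dE) [RHS](congr1 (@^~ w) gE).
Unshelve. all: by end_near. Qed.

(** In a chart [d] the field that is constantly [v] in the chart [c] has the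
    representative ['D_v (d \o c^-1)], read at [c \o d^-1]; it is cut off by a
    bump function supported in the domain of [c]. *)
Lemma C1field_through p0 (v : 'rV[R]_n) : exists X : C1field M, c1val X p0 = v.
Proof.
set c := chart_at p0.
have c0 : chart_dom c p0 := chart_at_dom p0.
have ac : atlas c := chart_at_atlas p0.
have [k [K [kC k1 cK KU kK]]] := bump (near_chart_img c0).
pose X : vfield M := fun p => if `[< chart_dom c p >] then
  'd (chart_at p \o chart_inv c) (c p) (k (c p) *: v) else 0.
have CK : closed (chart_inv c @` K).
  apply: compact_closed; first exact: points_hausdorff.
  apply: continuous_compact => //; apply: continuous_in_subspaceT => z.
  by rewrite inE => /KU [q cq <-]; exact: chart_inv_cont.
have X0 p : ~ (chart_inv c @` K) p -> X p = 0.
  rewrite /X; case: asboolP => // cp Kp; rewrite kK ?scale0r ?linear0 //.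
  by move=> Kcp; apply: Kp; exists (c p) => //; exact: chartK.
have XC : C1_on setT X.
  move=> d ad; rewrite setTI; apply/Ck1P; first exact: chart_img_open.
  (* Inside the domain of [c] the field is C^1 by its formula; at a point
     outside of it, the field is zero on the complement of a compact set. *)
  move=> _ [p dp <-]; have [cp|cp] := pselect (chart_dom c p).
    pose F := fun z => k z *: 'D_v (d \o chart_inv c) z.
    apply: (@C1_at_near _ _ _ (F \o (c \o chart_inv d))); last first.
      apply: C1_at_comp; first exact: transition_C1.
      rewrite /= (chartK dp); apply: C1_at_scale => //.
      exact: transition_derive_C1.
    near=> z; have [q [dq cq] <-] : (d @` (chart_dom d `&` chart_dom c)) z.
      by near: z; exact: near_overlap.
    rewrite /local_rep /= (chartK dq) /X asboolT // /in_chart transition_chain //.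
    - by rewrite linearZ /F deriveE //; exact: transition_diff.
    - exact: chart_at_atlas.
    - exact: chart_at_dom.
  apply: (@C1_at_near _ _ _ (cst 0)); last exact: C1_at_cst.
  have icont : chart_inv d @ d p --> p.
    by rewrite -{2}(chartK dp); exact: chart_inv_cont.
  have nK : \forall q \near p, (~` (chart_inv c @` K)) q.
    apply: open_nbhs_nbhs; split; first exact: closed_openC.
    move=> [z Kz zp]; apply: cp; rewrite -zp.
    by have [q cq <-] := KU _ Kz; rewrite chartK.
  near=> z; have zK : ~ (chart_inv c @` K) (chart_inv d z).
    by near: z; exact: (icont _ nK).
  by rewrite /local_rep X0 // /in_chart linear0.
exists (C1Field XC) => /=.
by rewrite /X asboolT // -/c k1 scale1r; exact: in_chart_at.
Unshelve. all: by end_near. Qed.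

End Charts.

(** * Torsion in a frame with vanishing components *)

Section Frame.
Variables (R : realType) (n : nat) (M : manifold R n).
Variables (S : S_map M) (E : local_basis M) (x0 : M).
Hypothesis Ex0 : lb_dom E x0.

Definition frame_coord (v : 'rV[R]_n) (i : 'I_n) : R :=
  coord [tuple E k x0 | k < n] i v.

Lemma frame_coordE v : v = \sum_i frame_coord v i *: E i x0.
Proof.
have [/eqP spanE _] := andP (lb_basis Ex0).
have := @coord_span _ _ _ [tuple E k x0 | k < n] v.
rewrite spanE memvf => /(_ isT) {1}->.
by apply: eq_bigr => i _; rewrite -tnth_nth tnth_mktuple.
Qed.

Lemma frame_coord_basis i j : frame_coord (E i x0) j = (i == j)%:R.
Proof.
have := @coord_free _ _ _ [tuple E k x0 | k < n] i j (basis_free (lb_basis Ex0)).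
by rewrite -tnth_nth tnth_mktuple.
Qed.

Hypothesis W0 : components_vanish_at S E x0.

Lemma frame_parallel (X : C1field M) j : S_derivation S X (E j) x0 = 0.
Proof.
by rewrite [LHS]frame_coordE big1 // => i _; rewrite [frame_coord _ _]W0 scale0r.
Qed.

(* An abbreviation for the differential of [Z] at [x0], typed as a plain
   function: the computation only uses [dE] and [bE]. *)
Let d (Z : vfield M) : 'rV[R]_n -> 'rV[R]_n :=
  'd (local_rep (chart_at x0) Z) (chart_at x0 x0).

Let dE Z v : d Z v = \sum_i frame_coord v i *: d Z (E i x0).
Proof.
rewrite [v in LHS]frame_coordE /d linear_sum; apply: eq_bigr => i _.
exact: linearZ.
Qed.

Let bE Z T : bracket Z T x0 = d T (Z x0) - d Z (T x0).
Proof. exact: bracketE. Qed.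

Let frame_mulS (X : C1field M) v :
  v *m S X x0 = d X v - \sum_j frame_coord v j *: d (E j) (c1val X x0).
Proof.
rewrite {1}[v]frame_coordE mulmx_suml dE -sumrB; apply: eq_bigr => j _.
rewrite -scalemxAl -scalerBr; congr (_ *: _).
have /eqP := frame_parallel X j.
by rewrite /S_derivation addrC addr_eq0 /lie_derivative bE opprB => /eqP.
Qed.

(** By [frame_mulS] the terms in [d X] and [d Y] cancel. Only the derivatives
    of the frame fields remain, in the directions of [X x0] and [Y x0];
    expanding these directions in the frame gives the brackets. *)
Lemma torsion_frame (X Y : C1field M) : torsion S X Y x0 =
  - \sum_i \sum_j (frame_coord (c1val X x0) i * frame_coord (c1val Y x0) j) *:
      bracket (E i) (E j) x0.
Proof.
have -> : torsion S X Y x0 =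
    \sum_i frame_coord (c1val X x0) i *: d (E i) (c1val Y x0)
    - \sum_j frame_coord (c1val Y x0) j *: d (E j) (c1val X x0).
  rewrite /torsion /S_derivation /lie_derivative !frame_mulS
    bE (bE (c1val Y)).
  move: (d X _) (d Y _) (\sum_i _) (\sum_i _) => A B u v.
  rewrite !addrA !subrK !opprB !addrA subrK.
  by rewrite addrAC (addrAC B) subrr add0r addrC.
under eq_bigr do rewrite dE scaler_sumr.
under [X in _ - X]eq_bigr do rewrite dE scaler_sumr.
rewrite [X in _ - X]exchange_big -sumrB -sumrN; apply: eq_bigr => i _ /=.
rewrite -sumrB -sumrN; apply: eq_bigr => j _.
rewrite bE -[RHS]scalerN opprB scalerBr !scalerA.
by rewrite [X in _ - X *: _]mulrC.
Qed.

End Frame.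

Theorem proposition12 (R : realType) (n : nat) (M : manifold R n)
    (S : S_map M) (x0 : M) :
  ((exists E : local_basis M,
      lb_dom E x0 /\ holonomic E /\ components_vanish_at S E x0) ->
   torsion_free_at S x0)
  /\
  (torsion_free_at S x0 ->
   (exists E : local_basis M, lb_dom E x0 /\ components_vanish_at S E x0) ->
   forall E : local_basis M, lb_dom E x0 -> components_vanish_at S E x0 ->
     holonomic_at E x0).
Proof.
split=> [[E [Ex0 [holE W0]]] X Y|tf _ E Ex0 W0 i j].
  rewrite (torsion_frame Ex0 W0) big1 ?oppr0 // => i _.
  by rewrite big1 // => j _; rewrite holE ?scaler0.
have [X Xi] := C1field_through x0 (E i x0).
have [Y Yj] := C1field_through x0 (E j x0).
have /eqP := tf X Y; rewrite (torsion_frame Ex0 W0) Xi Yj oppr_eq0.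
rewrite (bigD1 i) //= [X in _ + X]big1 => [|k ki]; last first.
  rewrite big1 // => l _.
  by rewrite frame_coord_basis // eq_sym (negbTE ki) mul0r scale0r.
rewrite addr0 (bigD1 j) //= [X in _ + X]big1 => [|l lj]; last first.
  by rewrite !frame_coord_basis // [j == l]eq_sym (negbTE lj) mulr0 scale0r.
by rewrite !frame_coord_basis // !eqxx mulr1 scale1r addr0 => /eqP.
Qed.
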